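(* Let $n\ge1$, let $k$ be even, let $\pi=(\pi_t)_{t\in\{1,\ldots,T\}}$ be a partition of $\{1,\ldots,k\}$ and let $\varepsilon\in\{\cdot,-\}^k$ be a balanced sequence. There exists a function $(p,q)\mapsto\mathrm{Wg}[\pi](p,q,n)$ on $P_k^\varepsilon\times P_k^\varepsilon$ such that, for $U=(U_{ij})$ Haar-distributed on the unitary group $\mathbb{U}_n$ and for all $x,y\in\{1,\ldots,n\}^k$, $$\mathbf{E}\left(\prod_{t=1}^T\Big[\prod_{i\in\pi_t}U_{x_iy_i}^{\varepsilon_i}\Big]\right)=\sum_{p,q\in P_k^\varepsilon}\delta_p(x)\,\delta_q(y)\,\mathrm{Wg}[\pi](p,q,n).$$
   Context: For an integrable random variable $X$, $[X]=X-\mathbf{E}(X)$. For $z\in\mathbb{C}$, $z^{\varepsilon}=z$ if $\varepsilon=\cdot$ and $z^\varepsilon=\overline z$ if $\varepsilon=-$. The sequence $\varepsilon\in\{\cdot,-\}^k$ is balanced if it has as many symbols $\cdot$ as symbols $-$. $P_k^\varepsilon$ is the set of pair partitions of $\{1,\ldots,k\}$ each of whose pairs $\{i,i'\}$ satisfies $\{\varepsilon_i,\varepsilon_{i'}\}=\{\cdot,-\}$. For a pair partition $p$ and $x\in\{1,\ldots,n\}^k$, $\delta_p(x)=1$ if $i\mapsto x_i$ is constant on each pair of $p$, and $\delta_p(x)=0$ otherwise. *)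

(* Defs.v *)
(* MathComp world: MathComp-Analysis over an arbitrary [R : realType], with the
   complex numbers [R[i]] of mathcomp-real-closed. *)
From HB Require Import structures.
From mathcomp Require Export all_boot all_order all_algebra.
From mathcomp Require Export complex.
From mathcomp Require Export all_classical all_reals all_analysis.

Set Implicit Arguments.
Unset Strict Implicit.
Unset Printing Implicit Defensive.

Import Order.TTheory GRing.Theory Num.Theory.
Import numFieldNormedType.Exports.

Local Open Scope classical_set_scope.
Local Open Scope complex_scope.
Local Open Scope ring_scope.

(* n x n complex matrices with their Borel sigma-algebra.  The regular-module
   alias [R[i]^o] carries the topology of the modulus. *)
Definition borel_mx (R : realType) (n : nat) :=
  g_sigma_algebraType (open : set (set 'M[R[i]^o]_n)).

(* U is distributed according to the Haar probability measure of the unitary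
   group, i.e. the unique probability measure on it that is invariant under
   left translations (the group being compact, it is also the unique
   right-invariant one). *)
Record haar_unitary (R : realType) (d : measure_display) (Omega : measurableType d)
    (P : probability Omega R) (n : nat) (U : Omega -> 'M[R[i]]_n) : Prop := {
  haar_measurable : measurable_fun setT (U : Omega -> borel_mx R n);
  haar_in_unitary : forall w : Omega, U w \is unitarymx;
  haar_invariant : forall (V : 'M[R[i]]_n) (A : set (borel_mx R n)),
    V \is unitarymx -> measurable A ->
    P ((fun w => V *m U w) @^-1` A) = P (U @^-1` A)
}.

(* Relies on [fine], hence meaningful for integrable Z only. *)
Definition cexpectation (R : realType) (d : measure_display)
    (Omega : measurableType d) (P : probability Omega R) (Z : Omega -> R[i]) : R[i] :=
  fine ('E_P[fun w => complex.Re (Z w)])%E +i* fine ('E_P[fun w => complex.Im (Z w)])%E.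

Definition centered (R : realType) (d : measure_display)
    (Omega : measurableType d) (P : probability Omega R) (Z : Omega -> R[i]) :
    Omega -> R[i] :=
  fun w => Z w - cexpectation P Z.

(* Symbols in {., -} are booleans: [true] is the conjugation symbol -. *)
Definition conj_pow (R : realType) (e : bool) (z : R[i]) : R[i] :=
  if e then z^* else z.

Local Close Scope classical_set_scope.
Local Open Scope set_scope.

Definition balanced (k : nat) (eps : 'I_k -> bool) : bool :=
  #|[set i | ~~ eps i]| == #|[set i | eps i]|.

Definition pair_partition (k : nat) (p : {set {set 'I_k}}) : bool :=
  finset.partition p [set: 'I_k] && [forall b in p, #|b| == 2%N].

Definition pair_partitions (k : nat) (eps : 'I_k -> bool) : {set {set {set 'I_k}}} :=
  [set p | pair_partition p &&
           [forall b in p, [set eps i | i in b] == [set false; true]]].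

Definition delta (k n : nat) (p : {set {set 'I_k}}) (x : 'I_k -> 'I_n) : bool :=
  [forall b in p, forall i in b, forall j in b, x i == x j].

(* Main.v *)
(* Let [W V] be the tensor product of the [V ^ eps i], acting on tensors of order k,
   and let [F x y] be the left-hand side. Expanding the centerings writes [F] as a
   combination of products of block moments over disjoint sets of indices; each block
   moment is invariant under left multiplication by a unitary, so every column of [F]
   is [W]-invariant. The matrix [M] of the full moments satisfies [M M' = M'] and
   [M^* M' = M'] for the moments [M'] of any other Haar variable, hence it is the
   orthogonal projection onto the invariants. The same argument block by block makes
   [F] Hermitian and independent of the Haar variable. By the first fundamental theorem
   of invariant theory the invariants are spanned by the [delta p], so [M = D a],
   [F = D b], and [F = M F = M F^* = D a b^* D^T].

   The first fundamental theorem is reduced to an operator [T] on the m-th tensor power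
   that commutes with all [V (x) ... (x) V], [V] unitary. Then [T] commutes with
   [A (x) ... (x) A] for diagonal [A] (compare the torus weights), for Hermitian [A]
   (spectral theorem), for all [A] (polynomial identity), and hence, by polarization,
   with all symmetrized products. Contracting this last relation against a functional
   that represents the identity in the span of the permutations exhibits [T] as a
   combination of permutations. *)
Require Import Defs.
From mathcomp Require Import measurable_realfun ring zify.

Set Implicit Arguments.
Unset Strict Implicit.
Unset Printing Implicit Defensive.

Import Order.TTheory GRing.Theory Num.Theory.
Import numFieldNormedType.Exports.

Local Open Scope classical_set_scope.
Local Open Scope complex_scope.
Local Open Scope ring_scope.

(** * Expectations of functions of a Haar variable *)

Section Admissible.
Variables (R : realType) (n : nat).
Local Notation C := R[i].

(** Coordinates are unbounded on the space of all matrices; the bound is asked on the unitary group,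
    where a Haar variable takes its values. *)
Definition admissible (g : 'M[C]_n -> C) :=
  [/\ measurable_fun setT (fun M : borel_mx R n => complex.Re (g M)),
      measurable_fun setT (fun M : borel_mx R n => complex.Im (g M)) &
      exists c : R, forall V, V \is unitarymx -> `|g V| <= c%:C].

Lemma admissible_cst c : admissible (fun=> c).
Proof.
split; [exact: measurable_cst|exact: measurable_cst|].
by exists (complex.Re `|c|) => V _; rewrite normc_def.
Qed.

Lemma admissibleD f g :
  admissible f -> admissible g -> admissible (fun M => f M + g M).
Proof.
move=> [fr fi [a fa]] [gr gi [b gb]]; split.
- have := measurable_funD fr gr; congr (measurable_fun _ _).
  by apply/funext => M /=; case: (f M) (g M) => [? ?] [? ?].
- have := measurable_funD fi gi; congr (measurable_fun _ _).
  by apply/funext => M /=; case: (f M) (g M) => [? ?] [? ?].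
- exists (a + b) => V uV; rewrite rmorphD /=.
  by rewrite (le_trans (ler_normD _ _))// lerD ?fa ?gb.
Qed.

Lemma admissibleM f g :
  admissible f -> admissible g -> admissible (fun M => f M * g M).
Proof.
move=> [fr fi [a fa]] [gr gi [b gb]]; split.
- have := measurable_funB (measurable_funM fr gr) (measurable_funM fi gi).
  congr (measurable_fun _ _).
  by apply/funext => M /=; case: (f M) (g M) => [? ?] [? ?].
- have := measurable_funD (measurable_funM fr gi) (measurable_funM fi gr).
  congr (measurable_fun _ _).
  by apply/funext => M /=; case: (f M) (g M) => [? ?] [? ?].
- exists (a * b) => V uV; rewrite rmorphM /= normrM.
  by rewrite ler_pM ?fa ?gb.
Qed.

Lemma admissible_conj f : admissible f -> admissible (fun M => (f M)^*).
Proof.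
move=> [fr fi [a fa]]; split.
- move: fr; congr (measurable_fun _ _).
  by apply/funext => M /=; case: (f M) => [? ?].
- have := measurable_funN fi; congr (measurable_fun _ _).
  by apply/funext => M /=; case: (f M) => [? ?].
- by exists a => V uV; rewrite normcJ fa.
Qed.

Lemma admissible_sum (I : Type) (r : seq I) (Q : pred I) (f : I -> 'M[C]_n -> C) :
  (forall i, Q i -> admissible (f i)) ->
  admissible (fun M => \sum_(i <- r | Q i) f i M).
Proof.
move=> af; elim: r => [|i r IH].
  under eq_fun do rewrite big_nil; exact: admissible_cst.
under eq_fun do rewrite big_cons.
by case: (boolP (Q i)) => // Qi; apply: admissibleD => //; exact: af.
Qed.

Lemma admissible_prod (I : Type) (r : seq I) (Q : pred I) (f : I -> 'M[C]_n -> C) :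
  (forall i, Q i -> admissible (f i)) ->
  admissible (fun M => \prod_(i <- r | Q i) f i M).
Proof.
move=> af; elim: r => [|i r IH].
  under eq_fun do rewrite big_nil; exact: admissible_cst.
under eq_fun do rewrite big_cons.
by case: (boolP (Q i)) => // Qi; apply: admissibleM => //; exact: af.
Qed.

Lemma admissible_conj_pow e f : admissible f -> admissible (fun M => conj_pow e (f M)).
Proof. by case: e => // /admissible_conj. Qed.

(** Each row of a unitary matrix has norm one. *)
Lemma le_norm_unitary (V : 'M[C]_n) i j : V \is unitarymx -> `|V i j| <= 1.
Proof.
move=> /unitarymxP/matrixP/(_ i i); rewrite !mxE eqxx => V1.
rewrite -(@expr_le1 _ 2)// -[leRHS]V1 (bigD1 j)//= !mxE -normCK lerDl.
by apply: sumr_ge0 => l _; rewrite !mxE -normCK exprn_ge0.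
Qed.

Lemma normc_ge_Im (z : C) : `|complex.Im z|%:C <= `|z|.
Proof.
rewrite -[leRHS]mulr1 -normCi -complexiE -normrM.
by apply: le_trans (normc_ge_Re _); rewrite ReiNIm normrN.
Qed.

Lemma open_coord (i j : 'I_n) (B : set C) :
  open (B : set C^o) -> open [set M : 'M[C^o]_n | B (M i j)].
Proof.
move=> oB; apply: (@open_comp _ _ (fun M : 'M[C^o]_n => M i j)) => // M _.
exact: (@coord_continuous C^o).
Qed.

Lemma open_lipschitz_preimage (f : C -> R) (a : R) :
  (forall z w, `|f z - f w|%:C <= `|z - w|) ->
  open ([set z : C^o | a < f z]).
Proof.
move=> lipf; rewrite openE => z /= az; apply/nbhs_ballP.
exists (f z - a)%:C; first by rewrite /= ltcR subr_gt0.
move=> w; rewrite -ball_normE /= => zw; have := le_lt_trans (lipf z w) zw.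
by rewrite ltcR => /(le_lt_trans (ler_norm _)); rewrite ltrD2l ltrN2.
Qed.

(** Open rays generate the Borel sets of the reals, and their preimages are open, hence generators
    of [borel_mx]. The real and imaginary parts satisfy the Lipschitz hypothesis. *)
Lemma measurable_coord (f : C -> R) (i j : 'I_n) :
  (forall z w, `|f z - f w|%:C <= `|z - w|) ->
  measurable_fun setT (fun M : borel_mx R n => f (M i j)).
Proof.
move=> lipf mD; apply: (measurability _ (RGenOInfty.measurableE R)) => //.
move=> _ [_ [a ->] <-]; rewrite setTI; apply: sub_gen_smallest.
have -> : (fun M : borel_mx R n => f (M i j)) @^-1` `]a, +oo[ =
   [set M : 'M[C^o]_n | [set z | a < f z] (M i j)].
  by apply/seteqP; split => M /=; rewrite in_itv /= andbT.
exact/open_coord/open_lipschitz_preimage.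
Qed.

Lemma admissible_coord i j : admissible (fun M => M i j).
Proof.
split.
- apply: measurable_coord => -[a b] [c d].
  by rewrite (le_trans _ (normc_ge_Re _))//= lexx.
- apply: measurable_coord => -[a b] [c d].
  rewrite -[leLHS]/(`|complex.Im (a +i* b - (c +i* d))|%:C).
  exact: normc_ge_Im.
- by exists 1 => V /le_norm_unitary; apply.
Qed.

Lemma admissible_mulmx_coord (V : 'M[C]_n) i j : admissible (fun M => (V *m M) i j).
Proof.
under eq_fun do rewrite mxE.
apply: admissible_sum => l _; apply: admissibleM; first exact: admissible_cst.
exact: admissible_coord.
Qed.

End Admissible.

(** * Linearity and translation invariance of expectations *)

Section Expectation.
Variables (R : realType) (n : nat) (d : measure_display).
Variables (Omega : measurableType d) (P : probability Omega R).
Variable U : Omega -> 'M[R[i]]_n.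
Hypothesis haarU : haar_unitary P U.
Local Notation C := R[i].
Local Notation E := (cexpectation P).

Lemma haar_Lfun (f : 'M[C]_n -> R) (c : R) :
  measurable_fun setT (f : borel_mx R n -> R) ->
  (forall V, V \is unitarymx -> `|f V| <= c) ->
  (fun w => f (U w)) \in Lfun P 1.
Proof.
move=> mf fc; apply/Lfun1_integrable; apply: measurable_bounded_integrable => //.
- by rewrite /= probability_setT ltry.
- exact: (measurableT_comp mf (haar_measurable haarU)).
- exists c; split; first exact: num_real.
  move=> a ca w _ /=; apply: le_trans (ltW ca).
  exact/fc/(haar_in_unitary haarU).
Qed.

Lemma admissible_Lfun g : admissible g ->
  (fun w => complex.Re (g (U w))) \in Lfun P 1 /\
  (fun w => complex.Im (g (U w))) \in Lfun P 1.
Proof.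
move=> [mr mi [c gc]]; split.
  apply: (@haar_Lfun (fun M => complex.Re (g M)) c) => // V uV.
  by rewrite -lecR; apply: le_trans (gc V uV); exact: normc_ge_Re.
apply: (@haar_Lfun (fun M => complex.Im (g M)) c) => // V uV.
by rewrite -lecR; apply: le_trans (gc V uV); exact: normc_ge_Im.
Qed.

Lemma cexpectation_cst c : E (fun=> c) = c.
Proof.
by rewrite /cexpectation !expectation_cst; case: c.
Qed.

Lemma cexpectationD f g : admissible f -> admissible g ->
  E (fun w => f (U w) + g (U w)) = E (fun w => f (U w)) + E (fun w => g (U w)).
Proof.
move=> /admissible_Lfun[fr fi] /admissible_Lfun[gr gi]; rewrite /cexpectation.
have -> : (fun w => complex.Re (f (U w) + g (U w))) =
    (fun w => complex.Re (f (U w))) \+ (fun w => complex.Re (g (U w))).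
  by apply/funext => w /=; case: (f _) (g _) => [? ?] [? ?].
have -> : (fun w => complex.Im (f (U w) + g (U w))) =
    (fun w => complex.Im (f (U w))) \+ (fun w => complex.Im (g (U w))).
  by apply/funext => w /=; case: (f _) (g _) => [? ?] [? ?].
by rewrite !expectationD// !fineD ?expectation_fin_num.
Qed.

Lemma cexpectationZ c g : admissible g ->
  E (fun w => c * g (U w)) = c * E (fun w => g (U w)).
Proof.
move=> /admissible_Lfun[gr gi]; rewrite /cexpectation.
case: c => a b.
have -> : (fun w => complex.Re ((a +i* b) * g (U w))) =
    (a \o* (fun w => complex.Re (g (U w)))) \- (b \o* (fun w => complex.Im (g (U w)))).
  by apply/funext => w /=; case: (g _) => [? ?] /=; rewrite ![_ * a]mulrC ![_ * b]mulrC.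
have -> : (fun w => complex.Im ((a +i* b) * g (U w))) =
    (a \o* (fun w => complex.Im (g (U w)))) \+ (b \o* (fun w => complex.Re (g (U w)))).
  by apply/funext => w /=; case: (g _) => [? ?] /=; rewrite ![_ * a]mulrC ![_ * b]mulrC.
have Z e f : f \in Lfun P 1 -> e \o* f \in Lfun P 1.
  move=> /Lfun1_integrable fL; apply/Lfun1_integrable.
  have := integrableZr measurableT e fL.
  by congr (_.-integrable _ _).
rewrite expectationB ?expectationD ?expectationZl ?Z//.
rewrite fineB ?fineD ?fineM ?fin_numM ?expectation_fin_num//.
Qed.

Lemma cexpectation_conj g : admissible g ->
  E (fun w => (g (U w))^*) = (E (fun w => g (U w)))^*.
Proof.
move=> /admissible_Lfun[gr gi]; rewrite /cexpectation.
have -> : (fun w => complex.Re (g (U w))^*) = (fun w => complex.Re (g (U w))).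
  by apply/funext => w; case: (g _).
have -> : (fun w => complex.Im (g (U w))^*) = (-1) \o* (fun w => complex.Im (g (U w))).
  by apply/funext => w /=; case: (g _) => [? ?] /=; rewrite mulrN1.
by rewrite expectationZl// fineM ?expectation_fin_num//= mulN1r.
Qed.

Lemma cexpectation_sum (I : Type) (r : seq I) (f : I -> 'M[C]_n -> C) :
  (forall i, admissible (f i)) ->
  E (fun w => \sum_(i <- r) f i (U w)) = \sum_(i <- r) E (fun w => f i (U w)).
Proof.
move=> af; elim: r => [|i r IH].
  under eq_fun do rewrite big_nil; by rewrite cexpectation_cst big_nil.
under eq_fun do rewrite big_cons.
rewrite big_cons -IH (@cexpectationD (f i) (fun M => \sum_(j <- r) f j M))//.
exact: admissible_sum.
Qed.

(** Both sides are integrals of the identity against laws on the reals, and [haar_invariant] makes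
    the two laws agree on every measurable set. *)
Lemma expectation_mull V (f : 'M[C]_n -> R) : V \is unitarymx ->
  measurable_fun setT (f : borel_mx R n -> R) ->
  measurable_fun setT (fun M : borel_mx R n => f (V *m M)) ->
  (fun w => f (U w)) \in Lfun P 1 -> (fun w => f (V *m U w)) \in Lfun P 1 ->
  'E_P[fun w => f (V *m U w)]%E = 'E_P[fun w => f (U w)]%E.
Proof.
move=> uV mf mVf fL fVL; rewrite unlock.
have mU := haar_measurable haarU.
have m1 : measurable_fun setT (fun w => f (U w)) by exact: (measurableT_comp mf mU).
have m2 : measurable_fun setT (fun w => f (V *m U w)) by exact: (measurableT_comp mVf mU).
have e1 := @integral_pushforward _ _ _ _ R _ m1 P setT EFin.
have e2 := @integral_pushforward _ _ _ _ R _ m2 P setT EFin.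
rewrite preimage_setT in e1 e2.
rewrite -[LHS]e2 -?[RHS]e1//; try exact/Lfun1_integrable.
apply: eq_measure_integral => A mA _.
have := haar_invariant haarU uV (mf measurableT _ mA).
by rewrite setTI.
Qed.

Lemma cexpectation_mull V g : V \is unitarymx -> admissible g ->
  admissible (fun M => g (V *m M)) ->
  E (fun w => g (V *m U w)) = E (fun w => g (U w)).
Proof.
move=> uV ag agV.
have [? ?] := admissible_Lfun ag; have [? ?] := admissible_Lfun agV.
case: ag agV => [? ? _] [? ? _].
rewrite /cexpectation (@expectation_mull V (fun M => complex.Re (g M)))//.
by rewrite (@expectation_mull V (fun M => complex.Im (g M))).
Qed.

End Expectation.

Local Close Scope classical_set_scope.
Local Open Scope set_scope.
Local Open Scope complex_scope.
Local Open Scope ring_scope.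
Local Open Scope sesquilinear_scope.

(** * The commutant of the tensor powers of the unitary group *)

Section Gram.
Variable C : numClosedFieldType.

Lemma conj_mulmx_eq0 m n (M : 'M[C]_(m, n)) : M ^t* *m M = 0 -> M = 0.
Proof.
move=> M0; apply/matrixP => i j; rewrite mxE; apply/eqP.
have /eqP := congr1 (fun N : 'M[C]_n => N j j) M0; rewrite !mxE.
rewrite psumr_eq0 => [/allP/(_ i (mem_index_enum i))|l _]; rewrite !mxE mulrC -normCK.
  by rewrite expf_eq0 normr_eq0.
exact: exprn_ge0.
Qed.

(** For a real matrix, a vector killed by [A^T *m A] is killed by [A], because the squared norm of
    its image vanishes; equal kernels give the inclusion of row spaces. *)
Lemma submx_gram m n (A : 'M[C]_(m, n)) : A ^t* = A^T -> (A <= A^T *m A)%MS.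
Proof.
move=> realA; rewrite submxE; apply/eqP/conj_mulmx_eq0.
rewrite trmx_mul map_mxM/= realA -!mulmxA [X in _ *m X]mulmxA mulmx_coker.
by rewrite mulmx0.
Qed.

(** This is [submx_gram] in coordinates. It trades the coefficients [c] for coefficients in the
    column space of [Q], a form that can be contracted with the relations of
    [commutant_symmetrized]. *)
Lemma gram_repr (G S : finType) (Q : G -> S -> C) (c : G -> C) :
  (forall g s, (Q g s)^* = Q g s) ->
  exists v : S -> C, forall s,
    \sum_g c g * Q g s = \sum_g (\sum_t v t * Q g t) * Q g s.
Proof.
move=> realQ.
pose A : 'M[C]_(#|G|, #|S|) := \matrix_(i, j) Q (enum_val i) (enum_val j).
pose u : 'rV[C]_#|G| := \row_i c (enum_val i).
have /submxP[w uA] : (u *m A <= A^T *m A)%MS.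
  by apply: submx_trans (submxMl _ _) (submx_gram _);
    apply/matrixP => i j; rewrite !mxE realQ.
exists (fun t => w 0 (enum_rank t)) => s.
have := congr1 (fun M : 'rV[C]_#|S| => M 0 (enum_rank s)) uA.
rewrite mulmxA !mxE (big_enum_val (A := G) (fun g => c g * Q g s)) => e.
transitivity (\sum_j u 0 j * A j (enum_rank s)).
  by apply: eq_bigr => j _; rewrite !mxE enum_rankK.
rewrite e (big_enum_val (A := G)); apply: eq_bigr => j _; rewrite !mxE enum_rankK.
congr (_ * _); rewrite (big_enum_val (A := S)); apply: eq_bigr => l _.
by rewrite !mxE enum_valK.
Qed.

End Gram.

(** * Permanents and polarization *)

Lemma injective_codom (T : finType) (f : T -> T) :
  injectiveb f = [forall i, i \in codom f].
Proof.
apply/injectiveP/forallP => [inj_f i|onto_f].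
  by apply: inj_card_onto.
have /image_injP inj : #|codom f| == #|T| by apply/eqP/eq_card.
by move=> x y; apply: inj.
Qed.

(** Inclusion-exclusion on the range of [f]: the signs of the sets [J] containing it add up to zero
    unless [f] is onto, that is, injective. This formula for permanents supplies the polarization
    below. *)
Lemma ryser (A : comPzRingType) (m : nat) (h : 'I_m -> 'I_m -> A) :
  \sum_(f : {ffun 'I_m -> 'I_m} | injectiveb f) \prod_j h (f j) j =
  \sum_(J : {set 'I_m}) (-1) ^+ #|~: J| * \prod_j \sum_(i in J) h i j.
Proof.
transitivity (\sum_(J : {set 'I_m}) \sum_(f : {ffun 'I_m -> 'I_m})
    (-1) ^+ #|~: J| * (\prod_j (f j \in J)%:R) * \prod_j h (f j) j).
  rewrite exchange_big big_mkcond; apply: eq_bigr => f _.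
  rewrite -big_distrl /=; set s := (X in X * _).
  suff -> : s = (injectiveb f)%:R by case: ifP; rewrite ?mul1r ?mul0r.
  rewrite injective_codom.
  (* The factor at [i] is 0 when [f] misses [i] and 1 otherwise. *)
  transitivity (\prod_i (1 + - (i \notin codom f)%:R) : A).
    rewrite bigA_distr; apply: eq_bigr => J _.
    have -> : \prod_j (f j \in J)%:R = [forall j, f j \in J]%:R :> A.
      case: forallP => [fJ|/forallP]; first by rewrite big1// => j _; rewrite fJ.
      by rewrite negb_forall => /existsP[j /negPf fj]; rewrite (bigD1 j)//= fj mul0r.
    rewrite -prodr_const (eq_bigl (fun i => i \notin J)); last by move=> i; rewrite inE.
    rewrite [RHS](bigID (mem J))/= [X in _ = X * _]big1 => [|i ->//]; rewrite mul1r.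
    rewrite [RHS](eq_bigr (fun i => -1 * (i \notin codom f)%:R)); last first.
      by move=> i /negPf ->; rewrite mulN1r.
    rewrite [RHS]big_split /=; congr (_ * _); case: forallP => [fJ|/forallP].
      rewrite big1// => i /negP iJ; case: (boolP (i \in codom f)) => // /codomP[j ij].
      by case: iJ; rewrite ij.
    rewrite negb_forall => /existsP[j fj].
    by rewrite (bigD1 (f j))//= codom_f mul0r.
  case: forallP => [ontof|/forallP].
    by rewrite big1// => i _; rewrite ontof subr0.
  rewrite negb_forall => /existsP[i fi].
  by rewrite (bigD1 i)//= fi subrr mul0r.
apply: eq_bigr => J _; under [LHS]eq_bigr => f _ do rewrite -mulrA.
rewrite -big_distrr /=; congr (_ * _).
under [RHS]eq_bigr do rewrite big_mkcond.
rewrite bigA_distr_bigA; apply: eq_bigr => f _ /=.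
rewrite -big_split; apply: eq_bigr => j _ /=.
by case: ifP; rewrite ?mul1r ?mul0r.
Qed.

Lemma prod_eq_nat (A : comPzRingType) (m n : nat) (a : {ffun 'I_m -> 'I_n})
    (u : 'I_m -> 'I_n) :
  \prod_j (a j == u j)%:R = (a == [ffun j => u j])%:R :> A.
Proof.
case: eqP => [->|/eqP]; first by rewrite big1// => j _; rewrite ffunE eqxx.
case: (boolP [forall j, a j == u j]) => [/forallP au /negP[]|].
  by apply/eqP/ffunP => j; rewrite ffunE; apply/eqP.
by rewrite negb_forall => /existsP[j /negPf au] _; rewrite (bigD1 j)//= au mul0r.
Qed.

(** * Operators commuting with the tensor powers of unitaries *)

Section Commutant.
Variables (C : numClosedFieldType) (n m : nat).
Local Notation word := {ffun 'I_m -> 'I_n}.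

(** Matrix entry of the tensor power of order [m] of [A], in the basis indexed by words. *)
Definition tensor_power (A : 'M[C]_n) (a b : word) : C := \prod_j A (a j) (b j).

Definition tensor_commutes (T : word -> word -> C) (A : 'M[C]_n) :=
  forall a b, \sum_z tensor_power A a z * T z b = \sum_z T a z * tensor_power A z b.

Lemma tensor_powerM A B a b :
  tensor_power (A *m B) a b = \sum_z tensor_power A a z * tensor_power B z b.
Proof.
rewrite /tensor_power; under eq_bigr do rewrite mxE.
by rewrite bigA_distr_bigA; apply: eq_bigr => z _; rewrite big_split.
Qed.

Variable T : word -> word -> C.

Lemma tensor_commutesM A B :
  tensor_commutes T A -> tensor_commutes T B -> tensor_commutes T (A *m B).
Proof.
move=> TA TB a b.
transitivity (\sum_z tensor_power A a z * (\sum_y tensor_power B z y * T y b)).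
  under [LHS]eq_bigr => z _ do rewrite tensor_powerM big_distrl.
  rewrite exchange_big; apply: eq_bigr => z _; rewrite big_distrr.
  by apply: eq_bigr => y _ /=; rewrite mulrA.
under [LHS]eq_bigr => z _ do rewrite TB big_distrr.
rewrite exchange_big /=.
transitivity (\sum_y (\sum_z tensor_power A a z * T z y) * tensor_power B y b).
  apply: eq_bigr => y _; rewrite big_distrl.
  by apply: eq_bigr => z _ /=; rewrite mulrA.
under [LHS]eq_bigr => y _ do rewrite TA big_distrl.
rewrite exchange_big; apply: eq_bigr => z _; rewrite tensor_powerM big_distrr.
by apply: eq_bigr => y _ /=; rewrite mulrA.
Qed.

Lemma tensor_power_diag (d : 'rV[C]_n) a b :
  tensor_power (diag_mx d) a b = (\prod_j d 0 (a j)) * (a == b)%:R.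
Proof.
rewrite /tensor_power; case: eqP => [->|/eqP].
  by rewrite mulr1; apply: eq_bigr => j _; rewrite mxE eqxx.
move=> ab; rewrite mulr0.
have /existsP[j jab] : [exists j, a j != b j].
  rewrite -negb_forall; apply: contra ab => /forallP ab; apply/eqP/ffunP => j.
  exact/eqP.
by rewrite (bigD1 j)//= mxE (negPf jab) mul0r.
Qed.

Lemma tensor_commutes_diag d : tensor_commutes T (diag_mx d) <->
  forall a b : word, (\prod_j d 0 (a j)) * T a b = (\prod_j d 0 (b j)) * T a b.
Proof.
have L a b : \sum_z tensor_power (diag_mx d) a z * T z b = (\prod_j d 0 (a j)) * T a b.
  rewrite (bigD1 a)//= tensor_power_diag eqxx mulr1 [X in _ + X]big1 ?addr0// => z za.
  by rewrite tensor_power_diag eq_sym (negPf za) mulr0 mul0r.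
have R a b : \sum_z T a z * tensor_power (diag_mx d) z b = (\prod_j d 0 (b j)) * T a b.
  rewrite (bigD1 b)//= tensor_power_diag eqxx mulr1 [X in _ + X]big1 ?addr0// => [|z zb].
    exact: mulrC.
  by rewrite tensor_power_diag (negPf zb) !mulr0.
by split=> h a b; move: (h a b); rewrite L R.
Qed.

(* Modulo 5, all the positive powers of [3 + 4i] equal [3 + 4i]. *)
Lemma unit_complex_infinite_order :
  exists2 z : C, z * z^* = 1 & forall k, z ^+ k.+1 != 1.
Proof.
have n5 : (5 : C) != 0 by rewrite pnatr_eq0.
exists ((3 + 4 * 'i) / 5).
  rewrite rmorphM fmorphV rmorphD rmorphM/= !rmorph_nat conjCi.
  have i2 : 'i * 'i = -1 :> C by rewrite -expr2 sqrCi.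
  have -> : (3 + 4 * 'i) / 5 * ((3 + 4 * - 'i) / 5) = (9 - 16 * ('i * 'i)) / (5 * 5) :> C.
    by rewrite mulrACA -invfM; congr (_ / _); ring.
  by rewrite i2 mulrN1 opprK -natrD -natrM divff// pnatr_eq0.
move=> k; rewrite expr_div_n; apply/eqP => /(canRL (mulfVK (expf_neq0 _ n5))).
have [p [q ->]] : exists p q : int,
    (3 + 4 * 'i) ^+ k.+1 = (3 + 5 * p)%:~R + (4 + 5 * q)%:~R * 'i :> C.
  elim: k => [|k [p [q IH]]]; first by exists 0, 0; rewrite expr1 !mulr0 !addr0.
  exists (3 * p - 4 * q - 2), (3 * q + 4 * p + 4); rewrite exprS IH.
  have i2 : 'i * 'i = -1 :> C by rewrite -expr2 sqrCi.
  rewrite !(intrD, intrM, intrB, rmorphN) /=.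
  have -> : (3 + 4 * 'i) * (3 + 5 * p%:~R + (4 + 5 * q%:~R) * 'i) =
    3 * (3 + 5 * p%:~R) + (4 * (4 + 5 * q%:~R)) * ('i * 'i) + 
    (3 * (4 + 5 * q%:~R) + 4 * (3 + 5 * p%:~R)) * 'i :> C by ring.
  rewrite i2; ring.
rewrite mul1r => /(congr1 (fun w : C => 'Im w)).
rewrite -natrX ['Im _%:R](Creal_ImP _ (realn _ _)) [_ * 'i]mulrC Im_rect ?realz//.
move=> /eqP; rewrite intr_eq0; lia.
Qed.

Hypothesis T_unitary : forall V, V \is unitarymx -> tensor_commutes T V.

(** The diagonal unitary with entry z at [l] and 1 elsewhere acts on a word through z to the number
    of occurrences of [l]. Commutation and the infinite order of z force equal numbers. *)
Lemma commutant_content a b l : T a b != 0 ->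
  #|[set j | a j == l]| = #|[set j | b j == l]|.
Proof.
move=> Tab; have [z z1 zk] := unit_complex_infinite_order.
have z0 : z != 0 by apply: contra_eq_neq z1 => ->; rewrite mul0r eq_sym oner_neq0.
pose d : 'rV[C]_n := \row_i (if i == l then z else 1).
have /tensor_commutes_diag/(_ a b)/(mulIf Tab) : tensor_commutes T (diag_mx d).
  apply: T_unitary; apply/unitarymxP; rewrite tr_diag_mx map_diag_mx mulmx_diag.
  apply/matrixP => i j; rewrite !mxE; congr (_ *+ _).
  by case: ifP => _ //; rewrite rmorph1 mulr1.
have cnt (c : word) : \prod_j d 0 (c j) = z ^+ #|[set j | c j == l]|.
  under eq_bigr do rewrite mxE.
  rewrite -big_mkcond prodr_const; congr (_ ^+ _).
  by apply: eq_card => j; rewrite inE.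
rewrite !cnt; move: #|_| #|_| => p q.
wlog pq : p q / (p <= q)%N => [hwlog|].
  by case: (leqP p q) => [/hwlog//|/ltnW/hwlog pq /esym/pq].
rewrite -(subnKC pq) exprD => e.
have := mulfI (expf_neq0 _ z0) (etrans e (esym (mulr1 _))).
case: (q - p)%N => [|k]; first by rewrite addn0.
by move/eqP; rewrite (negPf (zk k)).
Qed.

(** The eigenvalues of a diagonal tensor power depend only on the letter counts of words, which [T]
    preserves. *)
Lemma commutant_diag d : tensor_commutes T (diag_mx d).
Proof.
apply/tensor_commutes_diag => a b; case: (eqVneq (T a b) 0) => [->|Tab].
  by rewrite !mulr0.
have content (c : word) : \prod_j d 0 (c j) = \prod_l d 0 l ^+ #|[set j | c j == l]|.
  rewrite (partition_big c predT)//=; apply: eq_bigr => l _.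
  rewrite (eq_bigr (fun=> d 0 l)) => [|j /eqP->//]; rewrite prodr_const.
  by congr (_ ^+ _); apply: eq_card => j; rewrite inE.
rewrite !content; congr (_ * _); apply: eq_bigr => l _.
by rewrite (commutant_content l Tab).
Qed.

(** The spectral theorem reduces this to the unitary and diagonal cases. *)
Lemma commutant_normal A : A \is normalmx -> tensor_commutes T A.
Proof.
move=> /orthomx_spectralP ->.
have uA := spectral_unitarymx A.
apply: tensor_commutesM; last exact: T_unitary.
apply: tensor_commutesM; last exact: commutant_diag.
by apply: T_unitary; rewrite invmx_unitary// trmxC_unitary.
Qed.

(* [T] commutes with [H + tK] for [H], [K] Hermitian and [t] an integer, hence by
   polynomial identity also for [t = i]. *)
Lemma commutant_mx A : tensor_commutes T A.
Proof.
pose H : 'M[C]_n := 2^-1 *: (A + A ^t*).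
pose K : 'M[C]_n := - 'i / 2 *: (A - A ^t*).
have HK t : t^* = t -> tensor_commutes T (H + t *: K).
  move=> rt; apply: commutant_normal; apply: hermitian_normalmx.
  apply/is_hermitianmxP; rewrite expr0 scale1r; apply/matrixP => i j.
  rewrite !mxE rmorphD !rmorphM rmorphD rmorphB rmorphN fmorphV/=.
  rewrite !conjCK conjCi rmorph_nat rt.
  ring.
have AE : A = H + 'i *: K.
  apply/matrixP => i j; rewrite !mxE.
  have -> : 'i * (- 'i / 2 * (A i j - (A j i)^*)) =
     - ('i * 'i) * (2^-1 * (A i j - (A j i)^*)) :> C by ring.
  by rewrite -expr2 sqrCi opprK; field.
move=> a b.
pose L : 'M[{poly C}]_n := map_mx polyC H + 'X *: map_mx polyC K.
pose p : {poly C} := \sum_(z : word) (\prod_j L (a j) (z j)) * (T z b)%:P -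
  \sum_(z : word) (T a z)%:P * \prod_j L (z j) (b j).
have pE t : p.[t] = \sum_z tensor_power (H + t *: K) a z * T z b -
    \sum_z T a z * tensor_power (H + t *: K) z b.
  rewrite hornerD hornerN !horner_sum; congr (_ - _); apply: eq_bigr => z _;
    rewrite hornerM hornerC horner_prod; congr (_ * _);
    by apply: eq_bigr => j _; rewrite !mxE !hornerE.
have p0 : p = 0.
  apply: (@roots_geq_poly_eq0 _ _ [seq i%:R | i <- iota 0 (size p)]).
  - by apply/allP => _ /mapP[i _ ->]; rewrite /root pE HK ?subrr ?rmorph_nat.
  - by rewrite map_inj_uniq ?iota_uniq// => i j /eqP; rewrite eqr_nat => /eqP.
  - by rewrite size_map size_iota.
by apply/eqP; rewrite AE -subr_eq0 -pE p0 horner0.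
Qed.

Lemma tensor_power_delta (u v : 'I_m -> 'I_n) (a b : word) :
  \prod_j (delta_mx (u j) (v j) : 'M[C]_n) (a j) (b j) =
  (a == [ffun j => u j])%:R * (b == [ffun j => v j])%:R.
Proof.
under eq_bigr do rewrite mxE -mulnb natrM.
by rewrite big_split /= !prod_eq_nat.
Qed.

(** Both sides are entries of a product of [T] with the symmetrized tensor product of the matrix
    units at [u j], [v j]. By [ryser] this symmetrization is a signed combination of tensor powers,
    with which [T] commutes. *)
Lemma commutant_symmetrized (a b u v : word) :
  \sum_(f : {ffun 'I_m -> 'I_m} | injectiveb f)
    (a == [ffun j => u (f j)])%:R * T [ffun j => v (f j)] b =
  \sum_(f : {ffun 'I_m -> 'I_m} | injectiveb f)
    T a [ffun j => u (f j)] * (b == [ffun j => v (f j)])%:R.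
Proof.
pose W a b : C := \sum_(f : {ffun 'I_m -> 'I_m} | injectiveb f)
  (a == [ffun j => u (f j)])%:R * (b == [ffun j => v (f j)])%:R.
have WE c e : W c e = \sum_(J : {set 'I_m}) (-1) ^+ #|~: J| *
    tensor_power (\sum_(i in J) delta_mx (u i) (v i)) c e.
  transitivity (\sum_(f : {ffun 'I_m -> 'I_m} | injectiveb f)
      \prod_j (delta_mx (u (f j)) (v (f j)) : 'M[C]_n) (c j) (e j)).
    by apply: eq_bigr => f _; rewrite (tensor_power_delta (u \o f) (v \o f)).
  rewrite (ryser (fun i j => (delta_mx (u i) (v i) : 'M[C]_n) (c j) (e j))).
  apply: eq_bigr => J _; congr (_ * _); apply: eq_bigr => j _.
  by rewrite summxE.
have : \sum_z W a z * T z b = \sum_z T a z * W z b.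
  transitivity (\sum_(J : {set 'I_m}) (-1) ^+ #|~: J| *
    \sum_z tensor_power (\sum_(i in J) delta_mx (u i) (v i)) a z * T z b).
    under [LHS]eq_bigr => z _ do rewrite WE big_distrl.
    rewrite exchange_big; apply: eq_bigr => J _; rewrite big_distrr.
    by apply: eq_bigr => z _ /=; rewrite mulrA.
  under [LHS]eq_bigr => J _ do rewrite commutant_mx.
  under [RHS]eq_bigr => z _ do rewrite WE big_distrr.
  rewrite exchange_big; apply: eq_bigr => J _; rewrite big_distrr.
  by apply: eq_bigr => z _ /=; rewrite mulrCA.
under [X in X = _]eq_bigr => z _ do rewrite big_distrl.
under [X in _ = X]eq_bigr => z _ do rewrite big_distrr.
rewrite exchange_big [X in _ = X]exchange_big /= => e.
transitivity (\sum_(f : {ffun 'I_m -> 'I_m} | injectiveb f) \sum_z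
   (a == [ffun j => u (f j)])%:R * (z == [ffun j => v (f j)])%:R * T z b).
  apply: eq_bigr => f _.
  rewrite (bigD1 [ffun j => v (f j)])//= eqxx mulr1.
  rewrite [X in _ + X]big1 ?addr0// => z /negPf ->.
  by rewrite mulr0 mul0r.
rewrite e; apply: eq_bigr => f _.
rewrite (bigD1 [ffun j => u (f j)])//= eqxx mul1r [X in _ + X]big1 ?addr0// => z /negPf ->.
by rewrite mul0r mulr0.
Qed.

(** The identity is rewritten by [gram_repr] as a combination of permutation operators and inserted
    to the right of [T]; then [commutant_symmetrized] moves [T] into the coefficients. *)
Lemma commutant_tensor_powers :
  exists c : {ffun 'I_m -> 'I_m} -> C, forall a u,
    T a u = \sum_(f : {ffun 'I_m -> 'I_m} | injectiveb f)
      c f * (a == [ffun j => u (f j)])%:R.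
Proof.
pose Q (f : {ffun 'I_m -> 'I_m}) (s : word * word) : C :=
  (injectiveb f && (s.2 == [ffun j => s.1 (f j)]))%:R.
(* The coefficients single out the identity permutation, so that the left-hand side of [vE] at
   [(u, w)] is the indicator of [w = u]. *)
have [|v vE] := @gram_repr C _ _ Q (fun f => (f == finfun id)%:R).
  by move=> f s; rewrite rmorph_nat.
exists (fun f => \sum_s v s * T [ffun j => s.1 (f j)] s.2) => a u.
transitivity (\sum_w T a w * (w == u)%:R).
  rewrite (bigD1 u)//= eqxx mulr1 big1 ?addr0// => w /negPf ->.
  by rewrite mulr0.
transitivity (\sum_w T a w * \sum_f (\sum_s v s * Q f s) * Q f (u, w)).
  apply: eq_bigr => w _; rewrite -vE (bigD1 (finfun id))//= eqxx mul1r.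
  rewrite [X in _ + X]big1 ?addr0 => [|f /negPf->]; last by rewrite mul0r.
  rewrite /Q /=; congr (_ * _%:R).
  have -> : injectiveb (finfun id : {ffun 'I_m -> 'I_m}).
    by apply/injectiveP => i j; rewrite !ffunE.
  by congr (nat_of_bool (w == _)); apply/ffunP => j; rewrite !ffunE.
(* For each [s] the inner sum is the right-hand side of [commutant_symmetrized] at [a], [s.2], [u],
   [s.1]. *)
transitivity (\sum_s v s * \sum_(f : {ffun 'I_m -> 'I_m} | injectiveb f)
    T a [ffun j => u (f j)] * (s.2 == [ffun j => s.1 (f j)])%:R); last first.
  under [LHS]eq_bigr => s _ do rewrite -commutant_symmetrized big_distrr.
  rewrite exchange_big; apply: eq_bigr => f _; rewrite big_distrl.
  by apply: eq_bigr => s _ /=; rewrite -mulrA; congr (_ * _); exact: mulrC.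
under [LHS]eq_bigr => w _ do rewrite big_distrr.
rewrite exchange_big /=.
under [RHS]eq_bigr => s _ do rewrite big_distrr.
rewrite [RHS]exchange_big [RHS]big_mkcond; apply: eq_bigr => f _; rewrite /Q /=.
case: (injectiveb f); last by rewrite big1// => w _; rewrite !mulr0.
rewrite (bigD1 [ffun j => u (f j)])//= eqxx mulr1.
rewrite [X in _ + X]big1 ?addr0 => [|w /negPf->]; last by rewrite !mulr0.
by rewrite big_distrr; apply: eq_bigr => s _ /=; rewrite mulrCA.
Qed.

End Commutant.

(** * The invariants of mixed tensors *)

Section Kernel.
Variables (R : realType) (n k : nat) (eps : 'I_k -> bool).
Local Notation C := R[i].
Local Notation word := {ffun 'I_k -> 'I_n}.

(** Matrix entry of the operator acting by [V], conjugated according to [eps], on the tensor factors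
    in [A] and trivially on the others. Keeping all [k] factors lets the operators of different
    blocks be composed. *)
Definition kernel (A : {set 'I_k}) (V : 'M[C]_n) (x z : word) : C :=
  \prod_i (if i \in A then conj_pow (eps i) (V (x i) (z i)) else (x i == z i)%:R).

End Kernel.

(** Positions are enumerated symbol by symbol, and balance makes the two lists equally long. This is
    what turns a tensor of order [k] into a square operator on tensors of order [m]. *)
Lemma balanced_bij (k : nat) (eps : 'I_k -> bool) : balanced eps ->
  exists m (g : bool * 'I_m -> 'I_k), bijective g /\ forall s, eps (g s) = s.1.
Proof.
move=> /eqP bal.
pose g (s : bool * 'I_#|[set i | ~~ eps i]|) : 'I_k :=
  if s.1 then enum_val (cast_ord bal s.2) else enum_val s.2.
have eps_g s : eps (g s) = s.1.
  case: s => -[] j; rewrite /g /=.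
    by have := enum_valP (cast_ord bal j); rewrite inE.
  by have := enum_valP j; rewrite inE => /negPf.
exists _, g; split=> //; apply: inj_card_bij.
  move=> [b i] [b' j] e; have := congr1 eps e; rewrite !eps_g /= => bb'.
  move: e; rewrite -bb' /g; case: b {bb'} => /= /enum_val_inj; last by move->.
  by move/cast_ord_inj ->.
rewrite card_prod card_bool !card_ord.
have kE : (#|[set i | ~~ eps i]| + #|[set i | eps i]|)%N = k.
  rewrite addnC -[RHS](card_ord k) -(cardC (mem [set i | eps i])).
  by congr addn; apply: eq_card => i; rewrite !inE.
by apply: eq_leq; rewrite -[LHS]kE -bal addnn -mul2n.
Qed.

(** * Pair partitions from permutations *)

Section Pairing.
Variables (k m : nat) (eps : 'I_k -> bool) (g : bool * 'I_m -> 'I_k).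
Hypotheses (bij_g : bijective g) (eps_g : forall s, eps (g s) = s.1).
Variable f : {ffun 'I_m -> 'I_m}.

Definition pairing : {set {set 'I_k}} :=
  [set [set g (false, j); g (true, f j)] | j : 'I_m].

Hypothesis inj_f : injectiveb f.

Lemma pairing_partition : finset.partition pairing [set: 'I_k].
Proof.
have inj_g := bij_inj bij_g; have [h gK hK] := bij_g.
have onto_f j : exists i, j = f i.
  by move: inj_f; rewrite injective_codom => /forallP/(_ j)/codomP.
(* Label a conjugated position by its index and an unconjugated one by the image of its index under
   [f]; the pairs are the level sets of this label. *)
pose l i := let s := h i in if s.1 then s.2 else f s.2.
suff -> : pairing = preim_partition l [set: 'I_k] by exact: preim_partitionP.
have blockE j : [set g (false, j); g (true, f j)] = [set i in [set: 'I_k] | f j == l i].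
  apply/setP => i; rewrite !inE -(hK i) /l gK; case: (h i) => -[] a /=;
    rewrite !(inj_eq inj_g) !xpair_eqE /=; first by rewrite eq_sym.
  by rewrite orbF (inj_eq (injectiveP _ inj_f)) eq_sym.
have lE i : exists j, l i = f j by exact: onto_f.
apply/setP => B; apply/imsetP/imsetP => -[].
  move=> j _ ->; exists (g (true, f j)) => //; rewrite blockE.
  by apply/setP => i; rewrite !inE /l gK.
move=> i _ ->; have [j ij] := lE i; exists j => //; rewrite blockE.
by apply/setP => i'; rewrite !inE ij.
Qed.

Lemma pairing_pair_partitions : pairing \in pair_partitions eps.
Proof.
rewrite inE /pair_partition pairing_partition /=; apply/andP; split.
  apply/forallP => B; apply/implyP => /imsetP[j _ ->].
  by rewrite cards2 (inj_eq (bij_inj bij_g)).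
apply/forallP => B; apply/implyP => /imsetP[j _ ->].
by rewrite imsetU1 imset_set1 !eps_g.
Qed.

Lemma delta_pairing n (x : 'I_k -> 'I_n) :
  delta pairing x =
  ([ffun j => x (g (false, j))] == [ffun j => x (g (true, f j))]).
Proof.
apply/idP/eqP => [/forallP dx|/ffunP dx].
  apply/ffunP => j; rewrite !ffunE; apply/eqP.
  have := dx [set g (false, j); g (true, f j)].
  rewrite (imset_f (fun i => [set g (false, i); g (true, f i)]))//=.
  move=> /forallP/(_ (g (false, j))); rewrite set21 => /forallP/(_ (g (true, f j))).
  by rewrite set22.
apply/forallP => B; apply/implyP => /imsetP[j _ ->].
have {}dx : x (g (false, j)) = x (g (true, f j)) by have := dx j; rewrite !ffunE.
apply/forallP => i; apply/implyP => /set2P[]->; apply/forallP => i';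
  by apply/implyP => /set2P[]->; rewrite ?dx.
Qed.

End Pairing.

(** * The first fundamental theorem of invariant theory *)

Section FirstFundamentalTheorem.
Variables (R : realType) (n k : nat) (eps : 'I_k -> bool).
Local Notation C := R[i].
Local Notation word := {ffun 'I_k -> 'I_n}.

(** Read [f] as a matrix [T] with rows indexed by the unconjugated letters and columns by the
    conjugated ones. Invariance says that the tensor powers of [V] conjugate [T] to itself, so [T]
    is a combination of permutations, and the entries of a permutation are the [delta] of its
    pairing. *)
Lemma invariant_span_delta (f : word -> C) : balanced eps ->
  (forall V, V \is unitarymx ->
    forall x, \sum_z kernel eps [set: 'I_k] V x z * f z = f x) ->
  exists c : {set {set 'I_k}} -> C, forall x : word,
    f x = \sum_(p in pair_partitions eps) c p * (delta p x)%:R.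
Proof.
move=> /balanced_bij[m [g [bij_g eps_g]]] f_inv.
have [h gK hK] := bij_g.
pose merge (ab : {ffun 'I_m -> 'I_n} * {ffun 'I_m -> 'I_n}) : word :=
  [ffun i => let s := h i in if s.1 then ab.2 s.2 else ab.1 s.2].
pose splitw (x : word) : {ffun 'I_m -> 'I_n} * {ffun 'I_m -> 'I_n} :=
  ([ffun j => x (g (false, j))], [ffun j => x (g (true, j))]).
have mergeK : cancel merge splitw.
  by move=> [a b]; congr pair; apply/ffunP => j; rewrite !ffunE /= gK.
have splitK : cancel splitw merge.
  move=> x; apply/ffunP => i; rewrite !ffunE -[in RHS](hK i).
  by case: (h i) => -[] j; rewrite /= ffunE.
pose T a b := f (merge (a, b)).
have adjE (V : 'M[C]_n) (b d : {ffun 'I_m -> 'I_n}) :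
    (tensor_power V b d)^* = tensor_power (V ^t*) d b.
  by rewrite /tensor_power rmorph_prod; apply: eq_bigr => j _; rewrite !mxE.
have T_inv V : V \is unitarymx -> forall a b, T a b =
    \sum_c \sum_d tensor_power V a c * T c d * tensor_power (V ^t*) d b.
  move=> uV a b; rewrite /T -(f_inv V uV).
  rewrite (reindex merge) /=; last by exists splitw => x _; [exact: mergeK|exact: splitK].
  rewrite pair_bigA; apply: eq_bigr => -[c d] _ /=.
  rewrite mulrAC; congr (_ * _); rewrite -adjE /kernel.
  rewrite (reindex g) /=; last by exists h => s _; [exact: gK|exact: hK].
  pose F (e : bool) (j : 'I_m) := if e then (V (b j) (d j))^* else V (a j) (c j).
  transitivity (\prod_(s : bool * 'I_m) F s.1 s.2).
    by apply: eq_bigr => -[e j] _; rewrite finset.in_setT eps_g !ffunE gK /=; case: e.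
  rewrite -(pair_bigA _ F) big_bool mulrC /tensor_power rmorph_prod.
  by congr (_ * _).
have commT V : V \is unitarymx -> tensor_commutes T V.
  move=> uV a b; symmetry.
  under eq_bigr => z _ do rewrite (T_inv V uV) big_distrl.
  rewrite exchange_big; apply: eq_bigr => c _ /=.
  under eq_bigr => z _ do rewrite big_distrl.
  rewrite exchange_big /=.
  transitivity (\sum_d tensor_power V a c * T c d * (d == b)%:R).
    apply: eq_bigr => d _; under eq_bigr do rewrite -mulrA.
    rewrite -big_distrr /= -tensor_powerM; congr (_ * _).
    have -> : V ^t* *m V = 1%:M.
      by rewrite -[X in _ *m X]trmxCK; apply/unitarymxP; rewrite trmxC_unitary.
    rewrite -diag_const_mx tensor_power_diag big1 ?mul1r// => j _.
    by rewrite mxE.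
  rewrite (bigD1 b)//= eqxx mulr1 [X in _ + X]big1 ?addr0// => d /negPf ->.
  by rewrite mulr0.
have [c cE] := commutant_tensor_powers commT.
exists (fun p => \sum_(s : {ffun 'I_m -> 'I_m} | injectiveb s && (pairing g s == p)) c s).
move=> x; rewrite -(splitK x) -/(T _ _) cE.
rewrite (partition_big (pairing g) (mem (pair_partitions eps))) /=; last first.
  by move=> s; exact: pairing_pair_partitions.
apply: eq_bigr => p _; rewrite big_distrl; apply: eq_bigr => s /andP[_ /eqP <-].
rewrite delta_pairing splitK; congr (_ * (_ == _)%:R).
by apply/ffunP => j; rewrite !ffunE.
Qed.

End FirstFundamentalTheorem.

(** * Moments of a Haar variable *)

Section KernelTheory.
Variables (R : realType) (n k : nat) (eps : 'I_k -> bool).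
Local Notation C := R[i].
Local Notation word := {ffun 'I_k -> 'I_n}.
Local Notation kernel := (kernel eps).
Implicit Types (A B : {set 'I_k}) (V W : 'M[C]_n) (x y z : word).

Definition block_monomial A V x y : C :=
  \prod_(i in A) conj_pow (eps i) (V (x i) (y i)).

Definition glue A x y : word := [ffun i => if i \in A then x i else y i].

Lemma sum_prod_word (F G : 'I_k -> 'I_n -> C) :
  \sum_(z : word) (\prod_i F i (z i)) * (\prod_i G i (z i)) =
  \prod_i \sum_c F i c * G i c.
Proof. by rewrite bigA_distr_bigA; apply: eq_bigr => z _; rewrite big_split. Qed.

Lemma sum_eq_nat (a : 'I_n) (f : 'I_n -> C) : \sum_c (a == c)%:R * f c = f a.
Proof.
rewrite (bigD1 a)//= eqxx mul1r big1 ?addr0// => c; rewrite eq_sym => /negPf ->.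
by rewrite mul0r.
Qed.

(** Conjugation is taken entrywise, without transposition, so it is multiplicative and both symbols
    give representations. *)
Lemma kernelM A V W x y :
  \sum_z kernel A V x z * kernel A W z y = kernel A (V *m W) x y.
Proof.
rewrite (sum_prod_word
  (fun i c => if i \in A then conj_pow (eps i) (V (x i) c) else (x i == c)%:R)
  (fun i c => if i \in A then conj_pow (eps i) (W c (y i)) else (c == y i)%:R)).
apply: eq_bigr => i _; case: ifP => _; last by rewrite sum_eq_nat.
rewrite mxE; case: (eps i) => //=.
by rewrite rmorph_sum; apply: eq_bigr => c _; rewrite rmorphM.
Qed.

Lemma kernelU A B V x y : [disjoint A & B] ->
  kernel (A :|: B) V x y = \sum_z kernel A V x z * kernel B V z y.
Proof.
move=> dAB; rewrite (sum_prod_word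
  (fun i c => if i \in A then conj_pow (eps i) (V (x i) c) else (x i == c)%:R)
  (fun i c => if i \in B then conj_pow (eps i) (V c (y i)) else (c == y i)%:R)).
apply: eq_bigr => i _; rewrite finset.in_setU.
case: (boolP (i \in A)) => /= iA; last by rewrite sum_eq_nat.
rewrite (disjointFr dAB iA); under eq_bigr do rewrite mulrC eq_sym.
by rewrite sum_eq_nat.
Qed.

Lemma kernel_adj A V x y : (kernel A V x y)^* = kernel A (V ^t*) y x.
Proof.
rewrite /kernel rmorph_prod; apply: eq_bigr => i _; case: ifP => _.
  by rewrite !mxE; case: (eps i).
by rewrite rmorph_nat eq_sym.
Qed.

Lemma kernel_eq0 A V x z i : i \notin A -> x i != z i -> kernel A V x z = 0.
Proof.
by move=> /negPf iA /negPf xz; rewrite /kernel (bigD1 i)//= iA xz mul0r.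
Qed.

(** Outside [A] the kernel is an identity matrix, so the two words must be made to agree there;
    gluing changes the second word here and the first one in [block_monomial_gluel]. *)
Lemma block_monomial_gluer A V x y : block_monomial A V x y = kernel A V x (glue A y x).
Proof.
rewrite /block_monomial big_mkcond; apply: eq_bigr => i _; rewrite ffunE.
by case: ifP => // _; rewrite eqxx.
Qed.

Lemma block_monomial_gluel A V x y : block_monomial A V x y = kernel A V (glue A x y) y.
Proof.
rewrite /block_monomial big_mkcond; apply: eq_bigr => i _; rewrite ffunE.
by case: ifP => // _; rewrite eqxx.
Qed.

Lemma kernel_set0 V x z : kernel finset.set0 V x z = (x == z)%:R.
Proof.
transitivity (\prod_i (x i == z i)%:R : C); first by apply: eq_bigr => i _; rewrite inE.
by rewrite prod_eq_nat (_ : [ffun i => z i] = z)//; apply/ffunP => i; rewrite ffunE.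
Qed.

Lemma admissible_kernel A x y : admissible (fun V => kernel A V x y).
Proof.
apply: admissible_prod => i _; case: (i \in A); last exact: admissible_cst.
exact/admissible_conj_pow/admissible_coord.
Qed.

Lemma admissible_kernel_mull A W x y : admissible (fun V => kernel A (W *m V) x y).
Proof.
apply: admissible_prod => i _; case: (i \in A); last exact: admissible_cst.
exact/admissible_conj_pow/admissible_mulmx_coord.
Qed.

(** The second condition, dependence on the letters in [A] only, is what makes products over
    disjoint sets of positions invariant again. *)
Definition invariant_on A (f : word -> C) :=
  (forall V, V \is unitarymx -> forall x, \sum_z kernel A V x z * f z = f x) /\
  (forall x y, {in A, x =1 y} -> f x = f y).

Lemma invariant_onM A B f g : [disjoint A & B] ->
  invariant_on A f -> invariant_on B g ->
  invariant_on (A :|: B) (fun x => f x * g x).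
Proof.
(* The kernel on [A'] vanishes unless the letters outside [A'] agree, and these include all those on
   which [l] depends, so [l] comes out of the sum. *)
have split_inv A' B' (h l : word -> C) V x : [disjoint A' & B'] -> V \is unitarymx ->
    invariant_on A' h -> invariant_on B' l ->
    \sum_z kernel A' V x z * (h z * l z) = h x * l x.
  move=> dAB uV [h_inv _] [_ l_dep]; rewrite -(h_inv V uV) big_distrl.
  apply: eq_bigr => z _ /=; rewrite mulrA.
  case: (boolP [forall i in ~: A', x i == z i]) => [/forall_inP xz|].
    congr (_ * _); apply: l_dep => i iB; apply/esym/eqP/xz.
    by rewrite inE (disjointFl dAB iB).
  rewrite negb_forall_in => /existsP[i /andP[]]; rewrite inE => iA xz.
  by rewrite (kernel_eq0 V iA xz) !mul0r.
move=> dAB fA gB; split=> [V uV x|x y xy]; last first.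
  rewrite (fA.2 x y) ?(gB.2 x y)// => i iA; apply: xy; by rewrite inE iA ?orbT.
under eq_bigr => z _ do rewrite kernelU// big_distrl.
rewrite exchange_big /=.
rewrite -[RHS](split_inv A B f g V)//; apply: eq_bigr => z _.
rewrite [f z * _]mulrC -(split_inv B A g f V z) 1?disjoint_sym//.
by rewrite big_distrr; apply: eq_bigr => u _ /=; rewrite -mulrA [f u * _]mulrC.
Qed.

Lemma invariant_on_prod (I : finType) (Q : pred I) (B : I -> {set 'I_k})
    (f : I -> word -> C) :
  (forall s t, s != t -> [disjoint B s & B t]) ->
  (forall t, invariant_on (B t) (f t)) ->
  invariant_on (\bigcup_(t | Q t) B t) (fun x => \prod_(t | Q t) f t x).
Proof.
move=> dB fB; rewrite -big_filter.
have -> : (fun x => \prod_(t | Q t) f t x) =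
    (fun x => \prod_(t <- [seq t <- index_enum I | Q t]) f t x).
  by apply/funext => x; rewrite big_filter.
have := filter_uniq Q (index_enum_uniq I).
elim: [seq _ <- _ | _] => [_|t r IH /= /andP[tr ur]].
  have -> : (fun x => \prod_(t <- [::]) f t x) = (fun=> 1).
    by apply/funext => x; rewrite big_nil.
  rewrite big_nil; split=> // V _ x.
  under eq_bigr do rewrite kernel_set0 mulr1.
  rewrite (bigD1 x)//= eqxx big1 ?addr0// => z; rewrite eq_sym => /negPf ->.
  by [].
have -> : (fun x => \prod_(s <- t :: r) f s x) =
    (fun x => f t x * \prod_(s <- r) f s x).
  by apply/funext => x; rewrite big_cons.
rewrite big_cons; apply: invariant_onM => //; last exact: IH.
elim: r tr {IH ur} => [|s r IH]; first by rewrite big_nil -finset.setI_eq0 finset.setI0.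
rewrite inE negb_or big_cons => /andP[ts /IH].
by rewrite -!finset.setI_eq0 finset.setIUr finset.setU_eq0 => ->;
  rewrite finset.setI_eq0 dB.
Qed.

Lemma invariant_onN A f : invariant_on A f -> invariant_on A (fun x => - f x).
Proof.
move=> [f_inv f_dep]; split=> [V uV x|x y /f_dep -> //].
by under eq_bigr do rewrite mulrN; rewrite sumrN f_inv.
Qed.

Lemma invariant_on_sum A (I : Type) (r : seq I) (f : I -> word -> C) :
  (forall i, invariant_on A (f i)) -> invariant_on A (fun x => \sum_(i <- r) f i x).
Proof.
move=> fA; split=> [V uV x|x y xy]; last first.
  by apply: eq_bigr => i _; exact: (fA i).2.
under eq_bigr do rewrite big_distrr.
by rewrite exchange_big; apply: eq_bigr => i _; exact: (fA i).1.
Qed.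

End KernelTheory.

(** * Block moments as Hermitian matrices with invariant columns *)

Section Moments.
Variables (R : realType) (n k : nat) (eps : 'I_k -> bool).
Local Notation C := R[i].
Local Notation word := {ffun 'I_k -> 'I_n}.
Local Notation kernel := (kernel eps).
Local Notation invariant_on := (invariant_on eps).

Definition kernel_moment d (Omega : measurableType d) (P : probability Omega R)
    (U : Omega -> 'M[C]_n) (A : {set 'I_k}) (x y : word) : C :=
  cexpectation P (fun w => kernel A (U w) x y).

Definition block_moment d (Omega : measurableType d) (P : probability Omega R)
    (U : Omega -> 'M[C]_n) (A : {set 'I_k}) (x y : word) : C :=
  cexpectation P (fun w => block_monomial eps A (U w) x y).

Section OneHaar.
Variables (d : measure_display) (Omega : measurableType d).
Variables (P : probability Omega R) (U : Omega -> 'M[C]_n).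
Hypothesis haarU : haar_unitary P U.
Local Notation E := (cexpectation P).
Local Notation M := (kernel_moment P U).

(** The sum is the expectation of the kernel at [V *m U w], which has the law of [U w]. *)
Lemma kernel_moment_invariant A V x y : V \is unitarymx ->
  \sum_z kernel A V x z * M A z y = M A x y.
Proof.
move=> uV.
transitivity (\sum_z E (fun w => kernel A V x z * kernel A (U w) z y)).
  apply: eq_bigr => z _.
  rewrite (@cexpectationZ _ _ _ _ _ _ haarU _ (fun W => kernel A W z y))//.
  exact: admissible_kernel.
rewrite -(@cexpectation_sum _ _ _ _ _ _ haarU _ _
   (fun z W => kernel A V x z * kernel A W z y)); last first.
  by move=> z; apply: admissibleM; [exact: admissible_cst|exact: admissible_kernel].
under eq_fun do rewrite kernelM.
rewrite (@cexpectation_mull _ _ _ _ _ _ haarU V (fun W => kernel A W x y))//.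
  exact: admissible_kernel.
exact: admissible_kernel_mull.
Qed.

(** For every [w], [f] is fixed by the kernel of [U w] and by its adjoint, the kernel of another
    unitary matrix; the expectations are those of constants. *)
Lemma kernel_moment_average A (f : word -> C) :
  (forall V, V \is unitarymx -> forall x, \sum_z kernel A V x z * f z = f x) ->
  (forall x, \sum_z M A x z * f z = f x) /\ (forall x, \sum_z (M A z x)^* * f z = f x).
Proof.
move=> f_inv; split=> x.
  transitivity (\sum_z E (fun w => f z * kernel A (U w) x z)).
    apply: eq_bigr => z _; rewrite mulrC.
    rewrite (@cexpectationZ _ _ _ _ _ _ haarU _ (fun W => kernel A W x z))//.
    exact: admissible_kernel.
  rewrite -(@cexpectation_sum _ _ _ _ _ _ haarU _ _
     (fun z W => f z * kernel A W x z)); last first.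
    by move=> z; apply: admissibleM; [exact: admissible_cst|exact: admissible_kernel].
  rewrite -[RHS](cexpectation_cst P); congr cexpectation; apply/funext => w.
  under eq_bigr do rewrite mulrC.
  exact/f_inv/(haar_in_unitary haarU).
transitivity (\sum_z E (fun w => f z * (kernel A (U w) z x)^*)).
  apply: eq_bigr => z _; rewrite (@cexpectationZ _ _ _ _ _ _ haarU _
    (fun W => (kernel A W z x)^*)); last exact/admissible_conj/admissible_kernel.
  rewrite (@cexpectation_conj _ _ _ _ _ _ haarU (fun W => kernel A W z x)).
    exact: mulrC.
  exact: admissible_kernel.
rewrite -(@cexpectation_sum _ _ _ _ _ _ haarU _ _
   (fun z W => f z * (kernel A W z x)^*)); last first.
  move=> z; apply: admissibleM; first exact: admissible_cst.
  exact/admissible_conj/admissible_kernel.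
rewrite -[RHS](cexpectation_cst P); congr cexpectation; apply/funext => w.
under eq_bigr do rewrite mulrC kernel_adj.
by apply: f_inv; rewrite trmxC_unitary; exact: (haar_in_unitary haarU).
Qed.

(** The columns of [M A] are invariant, so averaging shows that the adjoint of [M A] times [M A] is
    [M A]; such a product is Hermitian. *)
Lemma kernel_moment_hermitian A x y : (M A y x)^* = M A x y.
Proof.
have avg u v := (kernel_moment_average
  (fun V uV x => @kernel_moment_invariant A V x v uV)).2 u.
rewrite -[in LHS]avg rmorph_sum -[RHS]avg.
by apply: eq_bigr => z _; rewrite rmorphM /= conjCK mulrC.
Qed.

Lemma block_momentE A x y : block_moment P U A x y = M A x (glue A y x).
Proof.
by congr cexpectation; apply/funext => w; rewrite block_monomial_gluer.
Qed.

(** Taking adjoints exchanges the two ways of gluing. *)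
Lemma block_moment_hermitian A x y :
  (block_moment P U A y x)^* = block_moment P U A x y.
Proof.
rewrite block_momentE kernel_moment_hermitian.
by congr cexpectation; apply/funext => w; rewrite block_monomial_gluel.
Qed.

(** The glued word varies with [x], so this is not a single column of the kernel moment. But the
    kernel preserves the letters outside [A], and the glued word depends on [x] only through
    them. *)
Lemma block_moment_invariant A y : invariant_on A (fun x => block_moment P U A x y).
Proof.
split=> [V uV x|x x' xx']; last first.
  congr cexpectation; apply/funext => w.
  by apply: eq_bigr => i iA; rewrite xx'.
rewrite block_momentE -(@kernel_moment_invariant A V x (glue A y x) uV).
apply: eq_bigr => z _; rewrite block_momentE.
case: (boolP [forall i in ~: A, x i == z i]) => [/forall_inP xz|].
  congr (_ * M A z _); apply/ffunP => i; rewrite !ffunE; case: ifPn => // iA.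
  by apply/esym/eqP/xz; rewrite inE.
rewrite negb_forall_in => /existsP[i /andP[]]; rewrite inE => iA xz.
by rewrite (kernel_eq0 eps V iA xz) !mul0r.
Qed.

End OneHaar.

(** For the two kernel moments M1 and M2, averaging gives M1 M2 = M2 and M2 M1 = M1. Both are
    Hermitian, so taking adjoints in the second equality gives M1 = M1 M2 = M2. This lets [Wg] be
    chosen before the Haar variable. *)
Lemma block_moment_unique d1 (O1 : measurableType d1) (P1 : probability O1 R) U1
    d2 (O2 : measurableType d2) (P2 : probability O2 R) U2 :
  haar_unitary P1 U1 -> haar_unitary P2 U2 ->
  block_moment P1 U1 = block_moment P2 U2.
Proof.
move=> h1 h2; apply/funext => A; apply/funext => x; apply/funext => y.
rewrite !(block_momentE P1, block_momentE P2); move: (glue A y x) => {}y.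
have avg1 u v := (kernel_moment_average h1
  (fun V uV x => @kernel_moment_invariant _ _ _ _ h2 A V x v uV)).1 u.
have avg2 u v := (kernel_moment_average h2
  (fun V uV x => @kernel_moment_invariant _ _ _ _ h1 A V x v uV)).1 u.
rewrite -(kernel_moment_hermitian h1) -avg2 -avg1 rmorph_sum.
apply: eq_bigr => z _; rewrite rmorphM /= mulrC.
by rewrite (kernel_moment_hermitian h1) (kernel_moment_hermitian h2).
Qed.

End Moments.

(** * Products of centered block monomials *)

Section CenteredMoments.
Variables (R : realType) (n k T : nat) (eps : 'I_k -> bool).
Variable pi : 'I_T -> {set 'I_k}.
Local Notation C := R[i].
Local Notation word := {ffun 'I_k -> 'I_n}.
Hypothesis pi_disjoint : forall s t, s != t -> [disjoint pi s & pi t].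
Hypothesis pi_cover : \bigcup_t pi t = [set: 'I_k].

(** Expansion of the product of centered blocks: those in [J] contribute their monomial, the others
    minus their mean. Only block moments enter, which gives the independence of the Haar
    variable. *)
Definition centered_moment (m : {set 'I_k} -> word -> word -> C) x y : C :=
  \sum_(J : {set 'I_T}) m (\bigcup_(t in J) pi t) x y *
    \prod_(t | t \notin J) (- m (pi t) x y).

Lemma block_monomial_bigcup (J : {set 'I_T}) (V : 'M[C]_n) (x y : word) :
  block_monomial eps (\bigcup_(t in J) pi t) V x y =
  \prod_(t in J) block_monomial eps (pi t) V x y.
Proof.
rewrite big_mkcond /block_monomial partition_disjoint_bigcup.
  rewrite [RHS]big_mkcond; apply: eq_bigr => t _; case: ifP => // _.
  by rewrite big_set0.
move=> s t st; rewrite -finset.setI_eq0.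
by do 2 case: ifP => _; rewrite ?finset.setI0 ?finset.set0I// finset.setI_eq0 pi_disjoint.
Qed.

Section OneHaar.
Variables (d : measure_display) (Omega : measurableType d).
Variables (P : probability Omega R) (U : Omega -> 'M[C]_n).
Hypothesis haarU : haar_unitary P U.
Local Notation m := (block_moment eps P U).

Lemma admissible_block_monomial A (x y : word) :
  admissible (fun V : 'M[C]_n => block_monomial eps A V x y).
Proof.
by apply: admissible_prod => i _; exact/admissible_conj_pow/admissible_coord.
Qed.

Lemma cexpectation_prod_centered (x y : word) :
  cexpectation P (fun w => \prod_(t < T)
    centered P (fun w' => block_monomial eps (pi t) (U w') x y) w) =
  centered_moment m x y.
Proof.
pose c (J : {set 'I_T}) : C := \prod_(t | t \notin J) (- m (pi t) x y).
transitivity (cexpectation P (fun w => \sum_(J : {set 'I_T})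
    c J * block_monomial eps (\bigcup_(t in J) pi t) (U w) x y)).
  congr cexpectation; apply/funext => w; rewrite bigA_distr.
  apply: eq_bigr => J _; rewrite block_monomial_bigcup [LHS](bigID (mem J)) [LHS]mulrC /=.
  congr (_ * _); apply: eq_bigr => t; first by move=> /negPf ->.
  by move=> ->.
rewrite (@cexpectation_sum _ _ _ _ _ _ haarU _ _
   (fun J V => c J * block_monomial eps (\bigcup_(t in J) pi t) V x y)); last first.
  move=> J; apply: admissibleM; first exact: admissible_cst.
  exact: admissible_block_monomial.
apply: eq_bigr => J _; rewrite mulrC (@cexpectationZ _ _ _ _ _ _ haarU _
    (fun V => block_monomial eps (\bigcup_(t in J) pi t) V x y)) 1?mulrC//.
exact: admissible_block_monomial.
Qed.

Lemma centered_moment_hermitian x y :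
  (centered_moment m y x)^* = centered_moment m x y.
Proof.
rewrite rmorph_sum; apply: eq_bigr => J _.
rewrite rmorphM /= (block_moment_hermitian eps haarU) rmorph_prod; congr (_ * _).
by apply: eq_bigr => t _; rewrite rmorphN /= (block_moment_hermitian eps haarU).
Qed.

Lemma centered_moment_invariant y :
  invariant_on eps [set: 'I_k] (fun x => centered_moment m x y).
Proof.
apply: invariant_on_sum => J.
(* The blocks in [J] enter through one moment over their union, each remaining block through its
   own. *)
have -> : [set: 'I_k] = (\bigcup_(t in J) pi t) :|: \bigcup_(t | t \notin J) pi t.
  by rewrite -pi_cover (bigID (mem J)).
apply: invariant_onM.
- apply/bigcup_disjointP => s sJ; rewrite disjoint_sym; apply/bigcup_disjointP => t tJ.
  by apply: pi_disjoint; apply: contraNneq sJ => ->.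
- exact: (block_moment_invariant eps haarU).
- apply: (@invariant_on_prod _ _ _ _ _ _ _ (fun t x => - m (pi t) x y)) => // t.
  exact/invariant_onN/(block_moment_invariant eps haarU).
Qed.

End OneHaar.

Lemma centered_moment_weingarten d (Omega : measurableType d)
    (P : probability Omega R) (U : Omega -> 'M[C]_n) :
  balanced eps -> haar_unitary P U ->
  exists Wg : {set {set 'I_k}} -> {set {set 'I_k}} -> C, forall x y,
    centered_moment (block_moment eps P U) x y =
    \sum_(p in pair_partitions eps) \sum_(q in pair_partitions eps)
      (delta p x)%:R * (delta q y)%:R * Wg p q.
Proof.
move=> bal haarU; set F := centered_moment _.
have /choice[a aE] y := invariant_span_delta bal
  (fun V uV x => @kernel_moment_invariant _ _ _ eps _ _ _ _ haarU [set: 'I_k] V x y uV).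
have /choice[b bE] y := invariant_span_delta bal (centered_moment_invariant haarU y).1.
exists (fun p q => \sum_z a z p * (b z q)^*) => x y.
rewrite /F -(kernel_moment_average haarU (centered_moment_invariant haarU y).1).1.
transitivity (\sum_z \sum_(p in pair_partitions eps)
    \sum_(q in pair_partitions eps)
      (delta p x)%:R * (delta q y)%:R * (a z p * (b z q)^*)).
  (* Hermitian symmetry moves the entry at [z], [y] from column [y] to column [z], whose expansion
     displays the dependence on [y] with coefficients [b z] free of [y]. *)
  apply: eq_bigr => z _; rewrite aE -(centered_moment_hermitian haarU) bE.
  rewrite rmorph_sum big_distrl; apply: eq_bigr => p _; rewrite big_distrr.
  apply: eq_bigr => q _; rewrite rmorphM /= rmorph_nat; ring.
rewrite exchange_big; apply: eq_bigr => p _; rewrite exchange_big.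
by apply: eq_bigr => q _; rewrite big_distrr.
Qed.

End CenteredMoments.

(** * The Weingarten expansion *)

Theorem proposition8 (R : realType) (n k T : nat)
    (n_ge1 : (1 <= n)%N) (k_even : ~~ odd k)
    (pi : 'I_T -> {set 'I_k}) (pi_inj : injective pi)
    (pi_part : finset.partition [set pi t | t : 'I_T] [set: 'I_k])
    (eps : 'I_k -> bool) (eps_balanced : balanced eps) :
  exists Wg : {set {set 'I_k}} -> {set {set 'I_k}} -> R[i],
    forall (d : measure_display) (Omega : measurableType d)
      (P : probability Omega R) (U : Omega -> 'M[R[i]]_n),
      haar_unitary P U ->
      forall x y : 'I_k -> 'I_n,
        cexpectation P (fun w => \prod_(t < T)
          centered P (fun w' => \prod_(i in pi t)
            conj_pow (eps i) (U w' (x i) (y i))) w)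
        = \sum_(p in pair_partitions eps) \sum_(q in pair_partitions eps)
            (delta p x)%:R * (delta q y)%:R * Wg p q.
Proof.
have /and3P[/eqP pi_cover /finset.trivIsetP pi_triv _] := pi_part.
have pi_disjoint s t : s != t -> [disjoint pi s & pi t].
  by move=> st; apply: pi_triv; rewrite ?imset_f// (inj_eq pi_inj).
have {}pi_cover : \bigcup_t pi t = [set: 'I_k].
  by rewrite -pi_cover cover_imset.
(* If there is no Haar variable, the zero function will do. Otherwise one variable defines [Wg], and
   [block_moment_unique] carries the identity to all the others. *)
have [|no_haar] := pselect (exists (d : measure_display) (Omega : measurableType d)
    (P : probability Omega R) (U : Omega -> 'M[R[i]]_n), haar_unitary P U); last first.
  exists (fun _ _ => 0) => d Omega P U haarU.
  by case: no_haar; exists d, Omega, P, U.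
case=> d' [S' [P' [U' haar']]].
have [Wg WgE] := centered_moment_weingarten pi_disjoint pi_cover eps_balanced haar'.
exists Wg => d Omega P U haarU x y.
have fE (u : 'I_k -> 'I_n) : u = [ffun i => u i] by apply/funext => i; rewrite ffunE.
rewrite [in RHS](fE x) [in RHS](fE y) -WgE (block_moment_unique eps haar' haarU).
rewrite -(cexpectation_prod_centered eps pi_disjoint haarU).
congr cexpectation; apply/funext => w; apply: eq_bigr => t _; congr centered.
by apply/funext => w'; apply: eq_bigr => i _; rewrite !ffunE.
Qed.
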